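(* Assume $G$ satisfies the Plausibility Assumption. Let $p$ be a polynomial in the indeterminates $x_{i,c}$ with $\deg_{\mathrm{mlin}}(p)\le\zeta\cdot\mathrm{SMALL}$, let $H'=\bigcup\{\mathrm{cl}(\mathrm{vbls}(M)) : M\text{ a monomial of }p\}$, and let $H$ be any small subgraph of $G$ containing $H'$. Then $\tilde{\mathbb E}[p]=\mathbb E_{x\sim\eta_H}[p(x)]=\mathbb E_{x\sim\eta_{H'}}[p(x)]$.
   Context: Fix a finite alphabet $\Omega$ with $|\Omega|=q\ge2$, integers $K\ge3$ and $3\le\tau\le K$. $G$ is a bipartite factor graph between variable-vertices $[n]$ and constraint-vertices; each constraint-vertex $f$ has an ordered neighbourhood $N(f)$ with $\tau-1\le|N(f)|\le K$ and a $(\tau-1)$-wise uniform distribution $\mu_f$ on $\Omega^{N(f)}$. A subgraph is an edge-induced subgraph $H=G[A]$ (possibly empty, not necessarily connected); $\mathrm{vbls}(H),\mathrm{cons}(H)$ are its variable-/constraint-vertices, $N_H(f)$ the variables adjacent to $f$ in $H$. $H$ is a $\tau$-subgraph if $|N_H(f)|\ge\tau$ for all $f\in\mathrm{cons}(H)$; a leaf is a variable-vertex of degree $1$ in $H$. Parameters $1\le\mathrm{SMALL}\le n/2$, $0<\zeta<1$, $K\le\zeta\cdot\mathrm{SMALL}$; $H$ is small if $|\mathrm{cons}(H)|\le\mathrm{SMALL}$. For a $\tau$-subgraph $H$: credits $=$ number of leaves; debits $=\sum_{i}\max(\deg_H(i)-2,0)+\sum_{f}(|N_H(f)|-\tau)$;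 revenue $R(H)=$ credits $-$ debits; income $I(H)=R(H)-\zeta|\mathrm{cons}(H)|$; plausible means $I(H)\ge0$. Plausibility Assumption: every $\tau$-subgraph with at most $2\cdot\mathrm{SMALL}$ constraint-vertices is plausible. $H$ is $S$-closed (for a variable set $S$) if it is a $\tau$-subgraph with all leaves in $S$; $\mathrm{cl}(S)$ is the union of all small $S$-closed $\tau$-subgraphs. For a small subgraph $H$, the planted distribution $\eta_H$ on $\Omega^n$: draw independently $w_f\sim\mu_f$ for $f\in\mathrm{cons}(H)$, regard $w_{f,i}$ ($i\in N_H(f)$) as the value suggested for $i$, condition on all suggestions to each $i\in\mathrm{vbls}(H)$ agreeing and let $x_i$ be the common value, and choose $x_i$ for $i\notin\mathrm{vbls}(H)$ independently uniformly. Indeterminates $x_{i,c}$ ($i\in[n],c\in\Omega$); for a polynomial $p$ in them, $\mathrm{vbls}(p)$ is the set of $i$ with some $x_{i,c}$ appearing in $p$, $\deg_{\mathrm{mlin}}(p)=\max|\mathrm{vbls}(M)|$ over monomials $M$ of $p$, and for $x\in\Omega^n$, $p(x)$ denotes evaluation at $x_{i,c}=\mathbf 1[x_i=c]$. $\tilde{\mathbb E}$ is the linear functional on polynomials of multilinear degree at most $\zeta\cdot\mathrm{SMALL}$ defined on monomials by $\tilde{\mathbb E}[M]=\mathbb E_{x\sim\eta_{\mathrm{cl}(\mathrm{vbls}(M))}}[M(x)]$ (these closures are small under the Plausibility Assumption). *)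

(* Defs.v *)
From mathcomp Require Import all_boot all_order all_algebra.
From mathcomp Require Import mpoly.

Set Implicit Arguments.
Unset Strict Implicit.
Unset Printing Implicit Defensive.

Import Order.TTheory GRing.Theory Num.Theory.
Local Open Scope ring_scope.

Section Subgraphs.
Variables (F : finType) (n : nat).

(* An edge-induced subgraph is identified with its set of edges (f, i),
   f a constraint-vertex and i a variable-vertex.  In particular it has no
   isolated vertices. *)
Definition subgraph := {set F * 'I_n}.

Implicit Types (H : subgraph) (f : F) (i : 'I_n) (S : {set 'I_n}).

Definition vbls H : {set 'I_n} := [set i | [exists f, (f, i) \in H]].
Definition constrs H : {set F} := [set f | [exists i, (f, i) \in H]].
Definition nbrs H f : {set 'I_n} := [set i | (f, i) \in H].
Definition deg H i : nat := #|[set f | (f, i) \in H]|.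
Definition leaves H : {set 'I_n} := [set i | deg H i == 1%N].

Definition tau_subgraph (tau : nat) H : bool :=
  [forall f in constrs H, (tau <= #|nbrs H f|)%N].

Definition credits H : int := #|leaves H|%:Z.
(* The truncated subtraction (deg H i - 2)%N is max(deg H i - 2, 0). *)
Definition debits (tau : nat) H : int :=
  (\sum_(i in vbls H) (deg H i - 2))%N%:Z
  + \sum_(f in constrs H) (#|nbrs H f|%:Z - tau%:Z).
Definition revenue (tau : nat) H : int := credits H - debits tau H.

Variable R : realFieldType.
Implicit Types (zeta SMALL : R).

Definition income (tau : nat) zeta H : R :=
  (revenue tau H)%:~R - zeta * #|constrs H|%:R.
Definition plausible (tau : nat) zeta H : bool := 0 <= income tau zeta H.
Definition small SMALL H : bool := #|constrs H|%:R <= SMALL.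

Definition S_closed (tau : nat) S H : bool :=
  tau_subgraph tau H && (leaves H \subset S).

End Subgraphs.

(* Omega^A, for A an explicitly enumerated set of coordinates. *)
Notation assignment A Omega := {ffun seq_sub A -> Omega}.

Definition wise_uniform (R : realFieldType) (I Omega : finType) (t : nat)
    (mu : {ffun I -> Omega} -> R) : Prop :=
  forall (T : {set I}) (a : {ffun I -> Omega}), #|T| = t ->
    \sum_(w : {ffun I -> Omega} | [forall i in T, w i == a i]) mu w
      = #|Omega|%:R ^- t.

Record factor_graph (R : realFieldType) (Omega F : finType) (n tau K : nat) :=
  FactorGraph {
    nbhd : F -> seq 'I_n;
    nbhd_uniq : forall f, uniq (nbhd f);
    nbhd_size : forall f, (tau.-1 <= size (nbhd f) <= K)%N;
    mu : forall f, assignment (nbhd f) Omega -> R;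
    mu_ge0 : forall f w, 0 <= @mu f w;
    mu_sum1 : forall f, \sum_w @mu f w = 1;
    mu_uniform : forall f, wise_uniform tau.-1 (@mu f)
  }.

Section FactorGraph.
Variables (R : realFieldType) (Omega F : finType) (n tau K : nat).
Variable G : factor_graph R Omega F n tau K.
Implicit Types (H : subgraph F n) (S : {set 'I_n}) (zeta SMALL : R).
Implicit Types (x : {ffun 'I_n -> Omega}).

Definition edges : subgraph F n := [set e | e.2 \in nbhd G e.1].

Definition Plausibility_Assumption zeta SMALL : Prop :=
  forall H, H \subset edges -> tau_subgraph tau H ->
    #|constrs H|%:R <= 2 * SMALL -> plausible tau zeta H.

Definition cl SMALL S : subgraph F n :=
  \bigcup_(H : subgraph F n |
      [&& H \subset edges, small SMALL H & S_closed tau S H]) H.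

(* The sample space of the draws w_f for f in constrs H. *)
Definition draws H : finType :=
  {dffun forall f : {f : F | f \in constrs H}, assignment (nbhd G (val f)) Omega}.

Definition draws_pr H (w : draws H) : R := \prod_f mu (w f).

(* (val f, val i) \in H says that i is in N_H(f), so that w f i is a value
   suggested for i. *)
Definition agree H (w : draws H) : bool :=
  [forall f, forall g,
     forall i : seq_sub (nbhd G (val f)), forall j : seq_sub (nbhd G (val g)),
     [&& (val f, val i) \in H, (val g, val j) \in H & val i == val j]
       ==> (w f i == w g j)].

Definition suggests H (w : draws H) x : bool :=
  [forall f, forall i : seq_sub (nbhd G (val f)),
     ((val f, val i) \in H) ==> (w f i == x (val i))].

(* The probability of x under the planted distribution.  The factor
   #|Omega| ^- (n - #|vbls H|) is the probability of the uniform choice of the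
   coordinates outside vbls H.  If the conditioning event has probability 0
   then eta H is identically 0; the Plausibility Assumption rules this out for
   small H. *)
Definition eta H x : R :=
  (\sum_(w : draws H | agree w && suggests w x)
      draws_pr w * #|Omega|%:R ^- (n - #|vbls H|))
  / \sum_(w : draws H | agree w) draws_pr w.

Definition expect (P : {ffun 'I_n -> Omega} -> R)
    (g : {ffun 'I_n -> Omega} -> R) : R := \sum_x P x * g x.

(* The indeterminate x_{i,c} is 'X_(enum_rank (i, c)). *)
Definition nvars : nat := #|{: 'I_n * Omega}|.

Definition mvbls (m : 'X_{1..nvars}) : {set 'I_n} :=
  [set i | [exists c : Omega, m (enum_rank (i, c)) != 0%N]].

Definition deg_mlin (p : {mpoly R[nvars]}) : nat :=
  \max_(m <- msupp p) #|mvbls m|.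

Definition peval (p : {mpoly R[nvars]}) x : R :=
  p.@[fun k : 'I_nvars => (x (enum_val k).1 == (enum_val k).2)%:R].

(* The extension by linearity of M |-> E_{x ~ eta_{cl(vbls M)}} [M(x)]; it is
   meaningful on polynomials of multilinear degree at most zeta * SMALL. *)
Definition pseudo_expect SMALL (p : {mpoly R[nvars]}) : R :=
  \sum_(m <- msupp p)
    p@_m * expect (eta (cl SMALL (mvbls m))) (peval 'X_[m]).

Definition cl_union SMALL (p : {mpoly R[nvars]}) : subgraph F n :=
  \bigcup_(m <- msupp p) cl SMALL (mvbls m).

End FactorGraph.

(* Main.v *)
Require Import Defs.
From mathcomp Require Import all_boot all_order all_algebra.
From mathcomp Require Import mpoly.
From mathcomp Require Import reals.

Set Implicit Arguments.
Unset Strict Implicit.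
Unset Printing Implicit Defensive.

Import Order.TTheory GRing.Theory Num.Theory.
Local Open Scope ring_scope.

(* With q = |Omega|, the planted distribution of H has density proportional to
   prod_f q^|N_H(f)| mu_f(w_f agrees with x on N_H(f)) with respect to the
   uniform distribution.  Summing this density against a function of x_S is
   unaffected by two operations on H: deleting an edge (f, i) where i is a leaf
   outside S (average over x_i), and deleting a constraint-vertex with fewer than
   tau neighbours (its factor is 1 by (tau-1)-wise uniformity).  Neither deletes
   an edge of cl(S), and when neither applies H is S-closed, so H = cl(S).
   Taking S empty, where cl(S) is empty by plausibility, shows that all small
   subgraphs have the same normalisation.  The union of the closures of the
   monomials lies in H and is thus small as well. *)

(** * Cylinder probabilities and wise uniformity *)

Section Cylinders.
Variables (R : realFieldType) (I Omega : finType).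
Implicit Types (T : {set I}) (a b x : {ffun I -> Omega}) (i : I) (c : Omega).
Implicit Types (nu phi : {ffun I -> Omega} -> R).

Definition update a i c : {ffun I -> Omega} :=
  [ffun j => if j == i then c else a j].

Definition cylinder nu T a : R :=
  \sum_(w : {ffun I -> Omega} | [forall i in T, w i == a i]) nu w.

Lemma eq_cylinder nu T a b : {in T, a =1 b} -> cylinder nu T a = cylinder nu T b.
Proof.
move=> eq_ab; apply: eq_bigl => w.
by apply: eq_forallb_in => i iT; rewrite eq_ab.
Qed.

Lemma cylinder0 nu a : cylinder nu set0 a = \sum_w nu w.
Proof. by apply: eq_bigl => w; apply/forall_inP => i; rewrite inE. Qed.

Lemma cylinder_split nu T a i : i \notin T ->
  cylinder nu T a = \sum_c cylinder nu (i |: T) (update a i c).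
Proof.
move=> iT; rewrite /cylinder (partition_big (fun w : {ffun I -> Omega} => w i) predT) //=.
apply: eq_bigr => c _; apply: eq_bigl => w.
apply/andP/forall_inP => [[/forall_inP wa /eqP wi] j | wa].
  by rewrite !inE ffunE; case: eqP => [-> _|_ /= /wa //]; rewrite wi.
split; last by have := wa i; rewrite !inE ffunE eqxx; apply.
apply/forall_inP => j jT; have := wa j; rewrite !inE ffunE jT orbT.
by rewrite (negPf (memPn iT _ jT)); apply.
Qed.

(** Exchanging [x i] with [c] is an involution on the pairs [(x, c)]; after it the summand no longer
    depends on the second component. *)
Lemma sum_update phi i :
  \sum_x \sum_c phi (update x i c) = #|Omega|%:R * \sum_x phi x.
Proof.
rewrite pair_big /=; pose swap (u : {ffun I -> Omega} * Omega) :=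
  (update u.1 i u.2, u.1 i).
have swapK : involutive swap.
  move=> [x c]; rewrite /swap /= ffunE eqxx; congr (_, _).
  by apply/ffunP => j; rewrite !ffunE; case: eqP => // ->.
rewrite (reindex_inj (inv_inj swapK)) /=.
rewrite (eq_bigr (fun u => phi u.1)) => [|u _]; last first.
  by have /(congr1 fst)/= -> := swapK u.
rewrite -(pair_big xpredT xpredT (fun x _ => phi x)) /= mulr_sumr.
by apply: eq_bigr => x _; rewrite sumr_const mulr_natl.
Qed.

(** Since [t < #|I|], some coordinate [i] lies outside [T]. Splitting the cylinder by the value at
    [i] gives [#|Omega|] cylinders on [t.+1] coordinates, each of known mass. *)
Lemma wise_uniform_pred t nu : (0 < #|Omega|)%N -> (t < #|I|)%N ->
  wise_uniform t.+1 nu -> wise_uniform t nu.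
Proof.
move=> q0 tI unif T a cardT.
have /subsetPn[i _ iT] : ~~ (setT \subset T).
  by rewrite subTset; apply: contraTneq tI => T1; rewrite -cardT T1 cardsT ltnn.
rewrite -/(cylinder nu T a) (cylinder_split _ _ iT).
under eq_bigr do rewrite [cylinder _ _ _]unif ?cardsU1 ?iT ?cardT //.
by rewrite sumr_const -[LHS]mulr_natl exprS invfM mulVKf // pnatr_eq0 -lt0n.
Qed.

Lemma wise_uniform_le s t nu : (0 < #|Omega|)%N -> (s <= t <= #|I|)%N ->
  wise_uniform t nu -> wise_uniform s nu.
Proof.
move=> q0 /andP[]; elim: t => [|t IHt]; first by rewrite leqn0 => /eqP ->.
rewrite leq_eqVlt => /predU1P[-> //|]; rewrite ltnS => st tI unif.
by apply: IHt => //; [apply: ltnW | apply: wise_uniform_pred].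
Qed.

Lemma card_eq_on T a :
  #|[pred x : {ffun I -> Omega} | [forall i in T, x i == a i]]|
    = (#|Omega| ^ #|~: T|)%N.
Proof.
pose Q i := if i \in T then pred1 (a i) else predT.
transitivity #|(family Q : simpl_pred {ffun I -> Omega})|.
  apply: eq_card => x; rewrite inE.
  apply/forall_inP/familyP => xa i; have := xa i; rewrite /Q.
    by case: (i \in T) => [/(_ isT)|].
  by move=> + iT; rewrite iT.
rewrite card_family foldrE big_image /=.
rewrite (bigID (mem T)) /= big1 => [|i iT]; last by rewrite /Q iT card1.
rewrite mul1n (eq_bigr (fun=> #|Omega|)) => [|i /negPf iT].
  by rewrite prod_nat_const; congr expn; apply: eq_card => i; rewrite !inE.
by rewrite /Q iT; apply: eq_card.
Qed.

End Cylinders.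

(** Draws at different constraint-vertices have different types, so distributivity is needed in
    dependent form. Passing through [fprod] turns the choices into functions to a single tagged sum
    type; the 0 in [untag] is the value at a wrong tag. *)
Lemma bigA_distr_dffun (R : comPzRingType) (I : finType) (T_ : I -> finType)
    (P_ : forall i, T_ i -> R) :
  \sum_(w : {dffun forall i, T_ i}) \prod_i P_ i (w i)
    = \prod_i \sum_(t : T_ i) P_ i t.
Proof.
pose Pf i : {ffun T_ i -> R} := [ffun t => P_ i t].
rewrite (reindex (@dffun_of_fprod I T_)); last exact/onW_bij/dffun_of_fprod_bij.
transitivity (\sum_(t : fprod T_) \prod_(i in I) Pf i (t i)).
  by apply: eq_bigr => t _; apply: eq_bigr => i _; rewrite !ffunE.
rewrite big_fprod -(bigA_distr_big_dep _ (fun i => untag 0 (Pf i))).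
apply: eq_bigr => i _; rewrite -(big_tag Pf).
by apply: eq_bigr => t _; rewrite ffunE.
Qed.

(** * The planted distribution as a normalised product *)

Section PlantedWeight.
Variables (R : realFieldType) (Omega F : finType) (n tau K : nat).
Variable G : factor_graph R Omega F n tau K.
Hypothesis Omega_gt0 : (0 < #|Omega|)%N.
Implicit Types (H : subgraph F n) (f : F) (i : 'I_n).
Implicit Types (x y : {ffun 'I_n -> Omega}) (c : Omega).

(** This is [nbrs H f] moved to the index type of the coordinates of [mu] at [f]. *)
Definition slots H f : {set seq_sub (nbhd G f)} := [set i | (f, val i) \in H].

Definition pull f x : assignment (nbhd G f) Omega := [ffun i => x (val i)].

Definition local_pr H f x : R := cylinder (@mu _ _ _ _ _ _ G f) (slots H f) (pull f x).

(** The power of [#|Omega|] compares the local probability with that of uniform values. The product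
    runs over all of [F], so that different subgraphs share one index set; a vertex outside
    [constrs H] contributes 1. *)
Definition weight H x : R :=
  \prod_f (#|Omega|%:R ^+ #|nbrs H f| * local_pr H f x).

Let q_neq0 : #|Omega|%:R != 0 :> R.
Proof. by rewrite pnatr_eq0 -lt0n. Qed.

Lemma card_slots H f : H \subset edges G -> #|slots H f| = #|nbrs H f|.
Proof.
move=> /subsetP HG; rewrite -(card_imset _ val_inj); apply: eq_card => i.
rewrite inE; apply/imsetP/idP => [[j + ->]|fi]; first by rewrite inE.
have fi' : i \in nbhd G f by have := HG _ fi; rewrite inE.
by exists (SeqSub fi'); rewrite ?inE.
Qed.

Lemma local_pr_eq H H' f x :
  nbrs H f = nbrs H' f -> local_pr H f x = local_pr H' f x.
Proof.
move=> /setP eqH; congr cylinder; apply/setP => i.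
by have := eqH (val i); rewrite !inE.
Qed.

Lemma local_pr_nbrs0 H f x : nbrs H f = set0 -> local_pr H f x = 1.
Proof.
move=> H0; rewrite -[RHS](mu_sum1 G f) -(cylinder0 _ (pull f x)).
congr cylinder; apply/setP => i.
by have /setP/(_ (val i)) := H0; rewrite !inE.
Qed.

Lemma constrsPn H f : reflect (nbrs H f = set0) (f \notin constrs H).
Proof.
rewrite inE; apply: (iffP existsPn) => [fN | /setP fN i].
  by apply/setP => i; rewrite !inE (negPf (fN i)).
by have := fN i; rewrite !inE => ->.
Qed.

(** For fixed [x] the condition splits into one condition per constraint-vertex, and independence
    turns the sum into a product. *)
Lemma sum_suggests H x :
  \sum_(w : draws G H | suggests w x) draws_pr w = \prod_f local_pr H f x.
Proof.
pose P (f : {f | f \in constrs H}) (t : assignment (nbhd G (val f)) Omega) : R :=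
  if [forall i in slots H (val f), t i == pull (val f) x i] then mu t else 0.
transitivity (\sum_(w : draws G H) \prod_f P f (w f)).
  rewrite big_mkcond; apply: eq_bigr => w _; case: ifPn => [/forallP wx | ].
    apply: eq_bigr => f _; rewrite /P ifT //; apply/forall_inP => i.
    by rewrite inE ffunE => fi; have /forallP/(_ i)/implyP := wx f; apply.
  case/forallPn => f /forallPn[i]; rewrite negb_imply => /andP[fi wi].
  rewrite (bigD1 f) //= /P ifF ?mul0r //; apply: contraNF wi.
  by move=> /forall_inP/(_ i); rewrite inE ffunE; apply.
rewrite bigA_distr_dffun [RHS](bigID (mem (constrs H))) /=.
rewrite [X in _ = _ * X]big1 ?mulr1 => [|f /constrsPn /local_pr_nbrs0 //].
rewrite [RHS]big_sub.
by apply: eq_bigr => f _; rewrite -big_mkcond.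
Qed.

Lemma suggests_agree H (w : draws G H) x : suggests w x -> agree w.
Proof.
move=> /forallP wx; apply/forallP => f; apply/forallP => g.
apply/forallP => i; apply/forallP => j; apply/implyP => /and3P[fi gj /eqP ij].
have /forallP/(_ i)/implyP/(_ fi)/eqP -> := wx f.
by have /forallP/(_ j)/implyP/(_ gj)/eqP -> := wx g; rewrite ij.
Qed.

Lemma agree_suggests H (w : draws G H) : agree w -> exists x, suggests w x.
Proof.
move=> /forallP agr; have /card_gt0P[c0 _] := Omega_gt0.
pose slot := {f : {f | f \in constrs H} & seq_sub (nbhd G (val f))}.
pose hit i (u : slot) := ((val (tag u), i) \in H) && (val (tagged u) == i).
(* Any slot of [H] over [i] may supply the value, since agreement makes them all equal; [c0] fills
   the coordinates over which there is none. *)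
exists [ffun i => if [pick u | hit i u] is Some u then w (tag u) (tagged u) else c0].
apply/forallP => f; apply/forallP => i; apply/implyP => fi; rewrite ffunE.
case: pickP => [u /andP[ui /eqP valu] | /(_ (existT _ f i))]; last first.
  by rewrite /hit /= fi eqxx.
have /forallP/(_ (tag u))/forallP/(_ i)/forallP/(_ (tagged u))/implyP := agr f.
by apply; rewrite fi valu ui eqxx.
Qed.

(** Once [w] suggests one [x0], it suggests exactly the assignments equal to [x0] on [vbls H].
    Containment in [edges G] gives each variable of [H] a slot where [w] has a value. *)
Lemma card_suggests H (w : draws G H) : H \subset edges G -> agree w ->
  #|[pred x | suggests w x]| = (#|Omega| ^ (n - #|vbls H|))%N.
Proof.
move=> /subsetP HG /agree_suggests[x0 /forallP wx0].
have -> : (n - #|vbls H|)%N = #|~: vbls H|.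
  by rewrite [RHS]cardsCs setCK card_ord.
rewrite -(card_eq_on (vbls H) x0); apply: eq_card => x; rewrite !inE.
apply/forallP/forall_inP => [wx i | xx0 f].
  rewrite inE => /existsP[f fi].
  have fH : f \in constrs H by rewrite inE; apply/existsP; exists i.
  have fi' : i \in nbhd G f by have := HG _ fi; rewrite inE.
  have /forallP/(_ (SeqSub fi'))/implyP/(_ fi)/eqP <- := wx (Sub f fH).
  by have /forallP/(_ (SeqSub fi'))/implyP/(_ fi) := wx0 (Sub f fH).
apply/forallP => i; apply/implyP => fi.
have /forallP/(_ i)/implyP/(_ fi)/eqP -> := wx0 f.
rewrite eq_sym; apply: xx0; rewrite inE; apply/existsP; exists (val f).
exact: fi.
Qed.

(** Every agreeing draw suggests equally many assignments, so the uniform factor of [eta] appears in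
    numerator and denominator and cancels, as do the powers of [#|Omega|] in [weight]. If the total
    weight is 0, both sides are 0 by the convention on division. *)
Lemma eta_weight H x : H \subset edges G ->
  eta G H x = weight H x / \sum_y weight H y.
Proof.
move=> HG; pose C : R := \prod_f #|Omega|%:R ^+ #|nbrs H f|.
pose N y : R := \prod_f local_pr H f y.
have C0 : C != 0 by apply/prodf_neq0 => f _; rewrite expf_neq0.
have wE y : weight H y = C * N y by rewrite /weight big_split.
rewrite wE (eq_bigr _ (fun y _ => wE y)) -mulr_sumr -mulf_div divff // mul1r.
rewrite /eta -mulr_suml; set e := _ ^- _.
have e0 : e != 0 by rewrite invr_eq0 expf_neq0.
have -> : \sum_(w : draws G H | agree w && suggests w x) draws_pr w = N x.
  rewrite /N -sum_suggests; apply: eq_bigl => w; rewrite andb_idl //.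
  exact: suggests_agree.
have -> : \sum_(w : draws G H | agree w) draws_pr w = (\sum_y N y) * e.
  rewrite /N (eq_bigr _ (fun y _ => esym (sum_suggests H y))).
  rewrite (exchange_big_dep (@agree _ _ _ _ _ _ G H)) /=; last first.
    by move=> y w _; apply: suggests_agree.
  rewrite mulr_suml; apply: eq_bigr => w agr.
  rewrite sumr_const (card_suggests HG agr) -[_ *+ _]mulr_natr -mulrA natrX.
  by rewrite mulfV ?mulr1 // expf_neq0.
by rewrite -mulf_div divff ?mulr1.
Qed.

End PlantedWeight.

(** * Closures *)

Section Subgraphs.
Variables (F : finType) (n : nat).
Implicit Types (H A : subgraph F n) (f h : F) (i : 'I_n).

Lemma mem_constrs H f i : (f, i) \in H -> f \in constrs H.
Proof. by move=> fi; rewrite inE; apply/existsP; exists i. Qed.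

Lemma constrsS A H : A \subset H -> constrs A \subset constrs H.
Proof.
move=> /subsetP AH; apply/subsetP => f; rewrite !inE => /existsP[i /AH fi].
by apply/existsP; exists i.
Qed.

Lemma nbrsS A H f : A \subset H -> nbrs A f \subset nbrs H f.
Proof. by move=> /subsetP AH; apply/subsetP => i; rewrite !inE => /AH. Qed.

Lemma degS A H i : A \subset H -> (deg A i <= deg H i)%N.
Proof.
move=> /subsetP AH; apply/subset_leq_card/subsetP => f.
by rewrite !inE => /AH.
Qed.

Lemma deg_gt0 H f i : (f, i) \in H -> (0 < deg H i)%N.
Proof. by move=> fi; apply/card_gt0P; exists f; rewrite inE. Qed.

Lemma deg1_inj H f h i :
  deg H i = 1%N -> (f, i) \in H -> (h, i) \in H -> f = h.
Proof.
move=> /eqP/cards1P[k /setP Hk] fi hi.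
have := Hk f; have := Hk h; rewrite !inE fi hi.
by move=> /esym/eqP -> /esym/eqP.
Qed.

Lemma smallS (R : realFieldType) (SMALL : R) A H :
  A \subset H -> small SMALL H -> small SMALL A.
Proof.
move=> AH; apply: le_trans; rewrite ler_nat.
exact/subset_leq_card/constrsS.
Qed.

End Subgraphs.

Section Closure.
Variables (R : realFieldType) (Omega F : finType) (n tau K : nat).
Variable G : factor_graph R Omega F n tau K.
Variable SMALL : R.
Implicit Types (H A : subgraph F n) (f h : F) (i : 'I_n) (S : {set 'I_n}).

Lemma cl_sub_edges S : cl G SMALL S \subset edges G.
Proof. by apply/bigcupsP => A /and3P[]. Qed.

Lemma sub_cl S H : H \subset edges G -> small SMALL H -> S_closed tau S H ->
  H \subset cl G SMALL S.
Proof. by move=> HG Hs Hc; apply: bigcup_sup; rewrite HG Hs Hc. Qed.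

Lemma mem_cl S e : e \in cl G SMALL S ->
  exists A, [/\ e \in A, A \subset cl G SMALL S, tau_subgraph tau A
              & leaves A \subset S].
Proof.
move=> /bigcupP[A /and3P[AG As Ac] eA]; exists A; split=> //.
- exact: sub_cl.
- by case/andP: Ac.
- by case/andP: Ac.
Qed.

(** A closed [A] inside the closure that contains [(f, i)] has degree at least 1 at [i], and at most
    [deg H i]; so [i] would be a leaf of [A] and hence in [S]. *)
Lemma cl_leaf S H f i : cl G SMALL S \subset H ->
  deg H i = 1%N -> i \notin S -> (f, i) \notin cl G SMALL S.
Proof.
move=> clH degi; apply: contra => /mem_cl[A [fi Acl _ /subsetP]]; apply.
rewrite inE eqn_leq (deg_gt0 fi) andbT -degi.
exact: degS (subset_trans Acl clH).
Qed.

Lemma cl_few_nbrs S H f i : cl G SMALL S \subset H ->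
  (#|nbrs H f| < tau)%N -> (f, i) \notin cl G SMALL S.
Proof.
move=> clH; rewrite ltnNge; apply: contra => /mem_cl[A [fi Acl /forall_inP tauA _]].
apply: leq_trans (tauA f (mem_constrs fi)) _.
exact/subset_leq_card/nbrsS/(subset_trans Acl).
Qed.

(** Without leaves the revenue is minus the debits, hence at most 0, so plausibility leaves no room
    for a constraint-vertex. *)
Lemma cl_set0 zeta : 0 <= SMALL -> 0 < zeta ->
  Plausibility_Assumption G zeta SMALL -> cl G SMALL set0 = set0.
Proof.
move=> SMALL0 zeta0 plaus; apply/eqP; rewrite -subset0.
apply/bigcupsP => A /and3P[AG As /andP[tauA]]; rewrite subset0 => /eqP leaf0.
have As2 : #|constrs A|%:R <= 2 * SMALL.
  by apply: le_trans As _; rewrite mulr_natl mulr2n lerDl.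
have := plaus A AG tauA As2.
rewrite /plausible /income /revenue /credits leaf0 cards0 sub0r => inc.
have deb : 0 <= debits tau A.
  rewrite addr_ge0 ?le0z_nat // sumr_ge0 // => f fA.
  by rewrite subr_ge0 lez_nat (forall_inP tauA).
have : zeta * #|constrs A|%:R <= 0.
  apply: le_trans (_ : - (debits tau A)%:~R <= 0); last first.
    by rewrite oppr_le0 ler0z.
  by rewrite -subr_ge0 -rmorphN.
rewrite pmulr_rle0 // lern0 cards_eq0 => /eqP A0.
rewrite subset0; apply/eqP/setP => -[f i]; rewrite in_set0.
by apply/negbTE/negP => /mem_constrs; rewrite A0 inE.
Qed.

End Closure.

(** * Peeling a subgraph down to a closure *)

Section Peeling.
Variables (R : realFieldType) (Omega F : finType) (n tau K : nat).
Variable G : factor_graph R Omega F n tau K.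
Hypothesis Omega_gt0 : (0 < #|Omega|)%N.
Implicit Types (H : subgraph F n) (f h : F) (i : 'I_n) (S : {set 'I_n}).
Implicit Types (x y : {ffun 'I_n -> Omega}) (g : {ffun 'I_n -> Omega} -> R).

Let q_neq0 : #|Omega|%:R != 0 :> R.
Proof. by rewrite pnatr_eq0 -lt0n. Qed.

Lemma local_pr_few_nbrs H f x : H \subset edges G -> (#|nbrs H f| < tau)%N ->
  local_pr G H f x = #|Omega|%:R ^- #|nbrs H f|.
Proof.
(* Fewer than [tau] neighbours means at most [tau.-1], and [nbhd G f] has at least [tau.-1] entries,
   so uniformity descends to this size. *)
move=> HG few; apply: (wise_uniform_le (t := tau.-1)) => //.
- rewrite card_seq_sub ?nbhd_uniq //; case/andP: (nbhd_size G f) => -> _.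
  by rewrite andbT -ltnS (ltn_predK few).
- exact: mu_uniform.
- exact: card_slots.
Qed.

Lemma weight_drop_constr H f x : H \subset edges G -> (#|nbrs H f| < tau)%N ->
  weight G H x = weight G [set e in H | e.1 != f] x.
Proof.
move=> HG few; apply: eq_bigr => h _.
have [->|hf] := eqVneq h f.
  have -> : nbrs [set e in H | e.1 != f] f = set0.
    by apply/setP => i; rewrite !inE /= eqxx andbF.
  rewrite local_pr_few_nbrs // mulfV ?expf_neq0 // local_pr_nbrs0.
    by rewrite cards0 mulr1.
  by apply/setP => i; rewrite !inE /= eqxx andbF.
have eqN : nbrs H h = nbrs [set e in H | e.1 != f] h.
  by apply/setP => i; rewrite !inE /= hf andbT.
by rewrite -eqN (local_pr_eq _ _ eqN).
Qed.

Lemma local_pr_update H f x i c : (f, i) \notin H ->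
  local_pr G H f (update x i c) = local_pr G H f x.
Proof.
move=> fi; apply: eq_cylinder => j; rewrite inE !ffunE.
by case: eqP => // -> fi'; rewrite fi' in fi.
Qed.

Lemma sum_local_pr_update H f x i : H \subset edges G -> (f, i) \in H ->
  \sum_c local_pr G H f (update x i c) = local_pr G (H :\ (f, i)) f x.
Proof.
move=> /subsetP HG fi; have fi' : i \in nbhd G f by have := HG _ fi; rewrite inE.
pose j : seq_sub (nbhd G f) := SeqSub fi'.
have jN : j \notin slots G (H :\ (f, i)) f by rewrite !inE eqxx.
rewrite /local_pr (cylinder_split _ _ jN); apply: eq_bigr => c _.
have -> : j |: slots G (H :\ (f, i)) f = slots G H f.
  apply/setP => k; rewrite !inE xpair_eqE eqxx /= -(inj_eq val_inj) /=.
  by case: eqP => //= ->; rewrite fi.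
congr cylinder; apply/ffunP => k.
by rewrite !ffunE -(inj_eq val_inj).
Qed.

(** As [i] is a leaf, only the factor at [f] sees [x i]. Summing over that value frees the
    coordinate in the cylinder, and the [#|Omega|] by which the power at [f] drops pays for the
    averaging. *)
Lemma sum_weight_drop_leaf H f i g : H \subset edges G -> (f, i) \in H ->
    deg H i = 1%N -> (forall x c, g (update x i c) = g x) ->
  \sum_x weight G H x * g x = \sum_x weight G (H :\ (f, i)) x * g x.
Proof.
(* Multiplying by [#|Omega|] lets the left side resample [x i]; the two sides then agree for each
   [x] separately. *)
move=> HG fi degi gi; apply: (mulfI q_neq0); rewrite -(sum_update _ i) mulr_sumr.
apply: eq_bigr => x _; under eq_bigr do rewrite gi.
rewrite -mulr_suml mulrA; congr (_ * _).
rewrite [in RHS]/weight (bigD1 f) //= !mulrA.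
set W := \prod_(h | h != f) _.
have wE c : weight G H (update x i c) =
    #|Omega|%:R ^+ #|nbrs H f| * local_pr G H f (update x i c) * W.
  rewrite /weight (bigD1 f) //=; congr (_ * _); apply: eq_bigr => h hf.
  have hi : (h, i) \notin H.
    by apply: contraNN hf => hi; rewrite (deg1_inj degi fi hi).
  have eqN : nbrs H h = nbrs (H :\ (f, i)) h.
    by apply/setP => j; rewrite !inE xpair_eqE (negPf hf).
  by rewrite eqN local_pr_update // (local_pr_eq _ _ eqN).
rewrite (eq_bigr _ (fun c _ => wE c)) -mulr_suml -mulr_sumr.
rewrite sum_local_pr_update //; congr (_ * _ * _).
rewrite (cardsD1 i) inE fi /= exprS; congr (_ * _ ^+ _).
by apply: eq_card => j; rewrite !inE xpair_eqE eqxx.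
Qed.

Lemma sum_weight_cl SMALL S H g :
    H \subset edges G -> small SMALL H -> cl G SMALL S \subset H ->
    (forall x y, {in S, x =1 y} -> g x = g y) ->
  \sum_x weight G H x * g x = \sum_x weight G (cl G SMALL S) x * g x.
Proof.
move=> + + + gS; have [k] := ubnP #|H|; elim: k H => // k IHk H.
rewrite ltnS => Hk HG Hs clH.
(* The induction is on the number of edges: a deletion must be strict and must keep the closure. *)
have peel H' : H' \proper H -> cl G SMALL S \subset H' ->
    \sum_x weight G H x * g x = \sum_x weight G H' x * g x ->
    \sum_x weight G H x * g x = \sum_x weight G (cl G SMALL S) x * g x.
  move=> ltH' clH' ->; apply: IHk => //.
  - exact: leq_trans (proper_card ltH') Hk.
  - exact: subset_trans (proper_sub ltH') HG.
  - exact: smallS (proper_sub ltH') Hs.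
have [tauH | ] := boolP (tau_subgraph tau H); last first.
  case/forall_inPn => f; rewrite inE => /existsP[i fi]; rewrite -ltnNge => few.
  apply: (peel [set e in H | e.1 != f]).
  - apply/properP; split; first by apply/subsetP => e; rewrite inE => /andP[].
    by exists (f, i) => //; rewrite inE eqxx andbF.
  - apply/subsetP => -[h j] hj; rewrite inE (subsetP clH) //=.
    by apply: contraTneq hj => ->; apply: cl_few_nbrs clH few.
  - by apply: eq_bigr => x _; rewrite (weight_drop_constr _ HG few).
have [leafS | /subsetPn[i]] := boolP (leaves H \subset S).
  suff -> : H = cl G SMALL S by [].
  apply/eqP; rewrite eqEsubset clH andbT; apply: sub_cl => //.
  by rewrite /S_closed tauH leafS.
rewrite inE => /eqP degi iS.
have /card_gt0P[f] : (0 < deg H i)%N by rewrite degi.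
rewrite inE => fi; apply: (peel (H :\ (f, i))); first exact: properD1.
- by rewrite subsetD1 clH; apply: cl_leaf clH degi iS.
- apply: sum_weight_drop_leaf => // x c; apply: gS => j jS.
  by rewrite ffunE; case: eqP iS => // <-; rewrite jS.
Qed.

Lemma expect_eta_cl SMALL zeta S H g : 0 <= SMALL -> 0 < zeta ->
    Plausibility_Assumption G zeta SMALL ->
    H \subset edges G -> small SMALL H -> cl G SMALL S \subset H ->
    (forall x y, {in S, x =1 y} -> g x = g y) ->
  expect (eta G H) g = expect (eta G (cl G SMALL S)) g.
Proof.
move=> SMALL0 zeta0 plaus HG Hs clH gS.
have cl0 := cl_set0 SMALL0 zeta0 plaus.
(* The case of the constant function 1, which depends on no coordinates, peels [H'] down to the
   closure of the empty set. *)
have norm H' : H' \subset edges G -> small SMALL H' ->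
    \sum_x weight G H' x = \sum_x weight G (set0 : subgraph F n) x.
  move=> H'G H's; have := @sum_weight_cl SMALL set0 H' (fun=> 1) H'G H's.
  rewrite cl0 sub0set => /(_ isT (fun _ _ _ => erefl)).
  by under eq_bigr do rewrite mulr1; move->; under eq_bigr do rewrite mulr1.
have expectE H' : H' \subset edges G -> small SMALL H' ->
    expect (eta G H') g =
    (\sum_x weight G H' x * g x) / \sum_x weight G (set0 : subgraph F n) x.
  move=> H'G H's; rewrite mulr_suml; apply: eq_bigr => x _.
  by rewrite eta_weight // norm // mulrAC.
rewrite !expectE ?cl_sub_edges //; last exact: smallS clH Hs.
by rewrite (sum_weight_cl HG Hs clH gS).
Qed.

End Peeling.

(** * Polynomials *)

Section Polynomials.
Variables (R : realFieldType) (Omega : finType) (n : nat).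
Implicit Types (p : {mpoly R[nvars Omega n]}) (m : 'X_{1..nvars Omega n}).

Lemma peval_monomial_eq m (x y : {ffun 'I_n -> Omega}) :
  {in mvbls m, x =1 y} -> peval ('X_[m] : {mpoly R[_]}) x = peval 'X_[m] y.
Proof.
move=> xy; rewrite /peval !mevalX; apply: eq_bigr => k _.
have [->|mk] := eqVneq (m k) 0%N; first by rewrite !expr0.
rewrite xy // inE; apply/existsP; exists (enum_val k).2.
by rewrite -surjective_pairing enum_valK.
Qed.

Lemma expect_peval (P : {ffun 'I_n -> Omega} -> R) p :
  expect P (peval p) = \sum_(m <- msupp p) p@_m * expect P (peval 'X_[m]).
Proof.
under [in RHS]eq_bigr do rewrite mulr_sumr.
rewrite exchange_big /=; apply: eq_bigr => x _.
rewrite /peval mevalE mulr_sumr; apply: eq_bigr => m _.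
by rewrite mevalX mulrCA.
Qed.

End Polynomials.

Theorem theorem5p16 (R : realType) (Omega F : finType) (n tau K : nat)
    (SMALL zeta : R) (G : factor_graph R Omega F n tau K)
    (Omega_ge2 : (2 <= #|Omega|)%N) (K_ge3 : (3 <= K)%N)
    (tau_ge3 : (3 <= tau)%N) (tau_leK : (tau <= K)%N)
    (SMALL_ge1 : 1 <= SMALL) (SMALL_le : SMALL <= n%:R / 2)
    (zeta_gt0 : 0 < zeta) (zeta_lt1 : zeta < 1)
    (K_le : K%:R <= zeta * SMALL)
    (G_plausible : Plausibility_Assumption G zeta SMALL)
    (p : {mpoly R[nvars Omega n]})
    (p_deg : (deg_mlin p)%:R <= zeta * SMALL)
    (H : subgraph F n) (H_sub : H \subset edges G) (H_small : small SMALL H)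
    (H_contains : cl_union G SMALL p \subset H) :
  pseudo_expect G SMALL p = expect (eta G H) (peval p) /\
  expect (eta G H) (peval p) = expect (eta G (cl_union G SMALL p)) (peval p).
Proof.
(* Both equalities follow from the cases [H' = H] and [H' = cl_union G SMALL p]. The expectation is
   expanded over the monomials, each of which needs only its own closure inside [H']. *)
have pseudoE (H' : subgraph F n) : H' \subset H -> cl_union G SMALL p \subset H' ->
    pseudo_expect G SMALL p = expect (eta G H') (peval p).
  move=> H'H clH'; rewrite expect_peval; apply: eq_big_seq => m mp.
  congr (_ * _); apply/esym; apply: (@expect_eta_cl _ _ _ _ _ _ _ _ _ zeta) => //.
  - exact: ltnW.
  - exact: le_trans SMALL_ge1.
  - exact: subset_trans H'H H_sub.
  - exact: smallS H'H H_small.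
  - by apply: subset_trans clH'; rewrite /cl_union (big_rem m mp) subsetUl.
  - exact: peval_monomial_eq.
by split; [apply: pseudoE | rewrite -!pseudoE].
Qed.
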